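(* Let $N\ge 1$ be an integer, let $V$ be an $N$-dimensional real Euclidean space with inner product $\langle\cdot,\cdot\rangle$ and norm $|\cdot|$, and let $m:V\to\mathbb{Z}_{\ge 0}$ be a map with support $S(m)=\{v\in V\mid m(v)\neq 0\}$ such that $m(0)=0$, $S(m)$ is a nonempty finite set, and $S(m)$ spans $V$ as an $\mathbb{R}$-vector space. Then the following two conditions on $m$ are equivalent: (F1) $\Lambda(m)$ is a subset of a sphere; that is, there exist $c\in V$ and $r>0$ such that $|\lambda-c|=r$ for every $\lambda\in\Lambda(m)$. (F2) $S(m)\cap(-S(m))=\emptyset$, the set $R:=S(m)\sqcup(-S(m))$ is a reduced finite root system of rank $N$ in $V$, and $m(s)=1$ for every $s\in S(m)$.
   Context: Group ring: $\mathbb{Z}[V]$ has $\mathbb{Z}$-basis the formal symbols $e^{v}$ ($v\in V$), with multiplication $e^{v_1}e^{v_2}=e^{v_1+v_2}$ and $e^{0}=1$. Define $$F(m):=\prod_{s\in S(m)}(1-e^{s})^{m(s)}=\sum_{\lambda\in V}c_\lambda e^{\lambda}\in\mathbb{Z}[V],\qquad \Lambda(m):=\{\lambda\in V\mid c_\lambda\neq 0\}.$$ For $\alpha\in V\setminus\{0\}$ the reflection $w_\alpha:V\to V$ is $w_\alpha(v)=v-\frac{2\langle\alpha,v\rangle}{|\alpha|^2}\alpha$. A subset $R\subset V\setminus\{0\}$ is a finite root system of rank $N$ if: (FR1) $R$ spans $V$ over $\mathbb{R}$; (FR2) $w_\alpha(R)=R$ for every $\alpha\in R$; (FR3) $\frac{2\langle\alpha,\beta\rangle}{|\alpha|^2}\in\mathbb{Z}$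 for all $\alpha,\beta\in R$. It is reduced if $\mathbb{R}\alpha\cap R=\{\alpha,-\alpha\}$ for every $\alpha\in R$. Notation: $-S=\{-s\mid s\in S\}$; $A=A_1\sqcup A_2$ means $A=A_1\cup A_2$ and $A_1\cap A_2=\emptyset$. *)

(* Defs.v *)
From HB Require Import structures.
From mathcomp Require Import all_boot all_order all_algebra finmap.
From mathcomp Require Import boolp classical_sets functions cardinality reals.
From mathcomp.multinomials Require Import monalg.

Set Implicit Arguments.
Unset Strict Implicit.
Unset Printing Implicit Defensive.

Import Order.TTheory GRing.Theory Num.Theory.

Local Open Scope ring_scope.
Local Open Scope classical_set_scope.

(* [monalg] gives the free Z-module [{malg int[V]}] on the type [V], but its
   product requires a monoid of exponents without nontrivial units, which
   excludes (V, +); hence the product below.  The alias [group_ring V] keeps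
   the two multiplicative structures apart. *)
Definition group_ring (V : zmodType) : Type := {malg int[V]}.

HB.instance Definition _ (V : zmodType) := GRing.Zmodule.on (group_ring V).

Section GroupRing.
Variable V : zmodType.

Implicit Types (f g h : group_ring V) (u v w : V) (a b : int).

Definition gr_coef (f : group_ring V) (v : V) : int := mcoeff v f.

(* a e^v *)
Definition gr_mono (a : int) (v : V) : group_ring V := mkmalgU v a.

Definition gr_exp (v : V) : group_ring V := gr_mono 1 v.

Definition gr_mul (f g : group_ring V) : group_ring V :=
  \sum_(u <- msupp f) \sum_(v <- msupp g)
     gr_mono (gr_coef f u * gr_coef g v) (u + v).

Lemma gr_mulw (A B : {fset V}) f g :
  fsubset (msupp f) A -> fsubset (msupp g) B ->
  gr_mul f g = \sum_(u <- A) \sum_(v <- B)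
     gr_mono (gr_coef f u * gr_coef g v) (u + v).
Proof.
move=> fA gB; rewrite /gr_mul (big_fset_incl _ fA) /=.
  apply: eq_bigr => u _; apply: big_fset_incl => // v _ /mcoeff_outdom gv0.
  by rewrite /gr_coef gv0 mulr0 /gr_mono monalgU0.
move=> u _ /mcoeff_outdom fu0; rewrite big1 // => v _.
by rewrite /gr_coef fu0 mul0r /gr_mono monalgU0.
Qed.

Lemma gr_mulC : commutative gr_mul.
Proof.
move=> f g; rewrite /gr_mul exchange_big /=.
by apply: eq_bigr => u _; apply: eq_bigr => v _; rewrite mulrC addrC.
Qed.

Lemma gr_mul_mono a b u v :
  gr_mul (gr_mono a u) (gr_mono b v) = gr_mono (a * b) (u + v).
Proof.
rewrite (gr_mulw msuppU_le msuppU_le) !big_seq_fset1.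
by rewrite /gr_coef !mcoeffUU.
Qed.

Lemma gr_mono_mul a u g :
  gr_mul (gr_mono a u) g =
  \sum_(v <- msupp g) gr_mono (a * gr_coef g v) (u + v).
Proof.
rewrite (gr_mulw msuppU_le (fsubset_refl _)) big_seq_fset1.
by apply: eq_bigr => v _; rewrite /gr_coef mcoeffUU.
Qed.

Lemma gr_mulE1 f g :
  gr_mul f g = \sum_(u <- msupp f) gr_mul (gr_mono (gr_coef f u) u) g.
Proof. by apply: eq_bigr => u _; rewrite gr_mono_mul. Qed.

Lemma gr_mulE2 f g :
  gr_mul f g = \sum_(v <- msupp g) gr_mul f (gr_mono (gr_coef g v) v).
Proof.
by rewrite gr_mulC gr_mulE1; apply: eq_bigr => v _; rewrite gr_mulC.
Qed.

Lemma gr_mul1 : left_id (gr_exp 0) gr_mul.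
Proof.
move=> g; rewrite /gr_exp gr_mono_mul [RHS]monalgE.
by apply: eq_bigr => v _; rewrite mul1r add0r.
Qed.

Lemma gr_mulDl : left_distributive gr_mul +%R.
Proof.
move=> f g h.
rewrite (gr_mulw (msuppD_le f g) (fsubset_refl _)).
rewrite (gr_mulw (fsubsetUl (msupp f) (msupp g)) (fsubset_refl (msupp h))).
rewrite (gr_mulw (fsubsetUr (msupp f) (msupp g)) (fsubset_refl (msupp h))).
rewrite -big_split /=; apply: eq_bigr => u _.
rewrite -big_split /=; apply: eq_bigr => v _.
by rewrite /gr_coef mcoeffD mulrDl /gr_mono monalgUD.
Qed.

Lemma gr_mulDr : right_distributive gr_mul +%R.
Proof. by move=> f g h; rewrite !(gr_mulC f) gr_mulDl. Qed.

Lemma gr_mul0g : left_zero 0 gr_mul.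
Proof. by move=> g; rewrite /gr_mul msupp0 big_seq_fset0. Qed.

Lemma gr_mulg0 : right_zero 0 gr_mul.
Proof. by move=> g; rewrite gr_mulC gr_mul0g. Qed.

Lemma gr_mulA : associative gr_mul.
Proof.
move=> f g h.
rewrite [RHS](big_morph (gr_mul^~ h) (fun _ _ => gr_mulDl _ _ _) (gr_mul0g _)).
rewrite gr_mulE1; apply: eq_bigr => u _.
rewrite [LHS](big_morph (gr_mul _) (fun _ _ => gr_mulDr _ _ _) (gr_mulg0 _)).
rewrite [RHS](big_morph (gr_mul^~ h) (fun _ _ => gr_mulDl _ _ _) (gr_mul0g _)).
apply: eq_bigr => v _.
rewrite [LHS](big_morph (gr_mul _) (fun _ _ => gr_mulDr _ _ _) (gr_mulg0 _)).
rewrite gr_mulE2; apply: eq_bigr => w _.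
by rewrite !gr_mul_mono mulrA addrA.
Qed.

Lemma gr_exp0_neq0 : gr_exp 0 != 0.
Proof. by rewrite monalgU_eq0 oner_eq0. Qed.

HB.instance Definition _ := GRing.Zmodule_isComNzRing.Build (group_ring V)
  gr_mulA gr_mulC gr_mul1 gr_mulDl gr_exp0_neq0.

Lemma gr_expD u v : gr_exp (u + v) = gr_exp u * gr_exp v.
Proof. by rewrite /gr_exp [RHS]gr_mul_mono mulr1. Qed.

Lemma gr_exp0 : gr_exp 0 = 1.
Proof. by []. Qed.

Lemma gr_coef_exp u v : gr_coef (gr_exp u) v = (u == v)%:R.
Proof. exact: mcoeffU. Qed.

End GroupRing.

Definition mult_supp (V : zmodType) (m : V -> nat) : set V :=
  [set v | m v != 0%N].

Definition opp_set (V : zmodType) (A : set V) : set V := [set - v | v in A].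

(* F(m).  The index sequence enumerates the support of m when it is finite;
   for an infinite support [fset_set] is the empty set. *)
Definition gr_F (V : zmodType) (m : V -> nat) : group_ring V :=
  \prod_(s <- fset_set (mult_supp m)) (1 - gr_exp s) ^+ m s.

Definition Lambda (V : zmodType) (m : V -> nat) : set V :=
  [set v | gr_coef (gr_F m) v != 0].

Section Euclidean.
Variables (R : realType) (V : vectType R) (ip : {dot V for (@idfun R)}).

Definition enorm (v : V) : R := Num.sqrt (ip v v).

Definition in_sphere (A : set V) : Prop :=
  exists (c : V) (r : R), 0 < r /\ forall v, A v -> enorm (v - c) = r.

Definition reflection (a v : V) : V :=
  v - (2 * ip a v / enorm a ^+ 2) *: a.

Definition spans (A : set V) : Prop :=
  forall v : V, exists2 X : seq V, [set` X] `<=` A & v \in <<X>>%VS.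

(* Finiteness of [A] is not required separately: it follows from the other
   conditions. *)
Definition finite_root_system (N : nat) (A : set V) : Prop :=
  [/\ \dim {:V} = N,
      A `<=` [set v | v != 0],
      spans A,
      (forall a, A a -> reflection a @` A = A) &
      (forall a b, A a -> A b -> 2 * ip a b / enorm a ^+ 2 \is a Num.int)].

Definition reduced (A : set V) : Prop :=
  forall a, A a -> [set k *: a | k in [set: R]] `&` A = [set a; - a].

Definition condF1 (m : V -> nat) : Prop := in_sphere (Lambda m).

Definition condF2 (N : nat) (m : V -> nat) : Prop :=
  let S := mult_supp m in
  [/\ S `&` opp_set S = set0,
      finite_root_system N (S `|` opp_set S),
      reduced (S `|` opp_set S) &
      forall s, S s -> m s = 1%N].

End Euclidean.

(* Main.v *)
(* Write [F(m) = e^c D] with [D = denom l] the product of the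
   [e^(-s/2) - e^(s/2)].

   (F1) => (F2).  A line meets a sphere in at most two points, and [D] is
   divisible by [e^(-a/2) - e^(a/2)] for [a] in the support of [m]; hence on each
   line directed by [a] the element [D] either vanishes or equals
   [k (e^y - e^z)], where [y] and [z] are exchanged by the affine reflection in
   direction [a] through the centre, and [y - z] is an integer multiple of [a].
   So [D] has no double zeros, i.e. no two parallel factors, and it is
   antisymmetric under these reflections.  A generic linear form vanishing on [a]
   attains its maximum on the exponents of [D] along one edge, which is a
   translate of [a].  Edges being permuted by the reflections, so are the vectors
   up to sign; the end points of the edges give integrality.

   (F2) => (F1).  The same edges show that [D] is antisymmetric under the Weyl
   group.  For each [r], the part of [D] supported on the sphere [ip v v = r] is
   then antisymmetric too, hence divisible by [D].  Unless that sphere contains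
   the vertices [w] and [-w] of [D] maximizing a generic linear form and its
   opposite, the quotient would have a negative maximum and a positive minimum
   for this form, so the part is zero. *)

Require Import Defs.
From mathcomp Require Import all_boot all_order all_algebra finmap.
From mathcomp Require Import boolp classical_sets functions cardinality reals.
From mathcomp.multinomials Require Import monalg.
From mathcomp Require Import ring lra.

Set Implicit Arguments.
Unset Strict Implicit.
Unset Printing Implicit Defensive.

Import Order.TTheory GRing.Theory Num.Theory.

Local Open Scope ring_scope.

(** * Coefficients in the group ring *)

Section Coefficients.
Variable V : zmodType.
Implicit Types (f g : group_ring V) (u v : V).

Lemma gr_coefD f g v : gr_coef (f + g) v = gr_coef f v + gr_coef g v.
Proof. exact: mcoeffD. Qed.

Lemma gr_coefN f v : gr_coef (- f) v = - gr_coef f v.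
Proof. exact: mcoeffN. Qed.

Lemma gr_coefB f g v : gr_coef (f - g) v = gr_coef f v - gr_coef g v.
Proof. exact: mcoeffB. Qed.

Lemma gr_coef0 v : gr_coef 0 v = 0.
Proof. exact: mcoeff0. Qed.

Lemma gr_coef_sum (I : Type) (r : seq I) (P : pred I) (F : I -> group_ring V) v :
  gr_coef (\sum_(i <- r | P i) F i) v = \sum_(i <- r | P i) gr_coef (F i) v.
Proof.
by elim/big_rec2: _ => [|i y x _ <-]; rewrite (gr_coef0, gr_coefD).
Qed.

Lemma gr_coef_mono (a : int) u v : gr_coef (gr_mono a u) v = a *+ (u == v).
Proof. exact: mcoeffU. Qed.

Lemma gr_ext f g : (forall v, gr_coef f v = gr_coef g v) -> f = g.
Proof. by move/malgP. Qed.

Lemma mem_msupp f v : (v \in msupp f) = (gr_coef f v != 0).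
Proof. by rewrite -mcoeff_neq0. Qed.

Lemma gr_neq0P f : f != 0 -> exists v, gr_coef f v != 0.
Proof.
move=> fN0; apply: contrapT => /forallNP f0; case/eqP: fN0.
by apply: gr_ext => v; rewrite gr_coef0; apply/eqP/negPn/negP => /f0.
Qed.

Lemma gr_coef_monoM (a : int) u g v :
  gr_coef (gr_mono a u * g) v = a * gr_coef g (v - u).
Proof.
rewrite [_ * _]gr_mono_mul gr_coef_sum.
under eq_bigr do rewrite gr_coef_mono.
have eqE (x : V) : (u + x == v) = (x == v - u).
  by rewrite addrC -subr_eq0 opprB addrA subr_eq0 eq_sym addrC -subr_eq addrC.
under eq_bigr do rewrite eqE.
have [vu|vu] := boolP (v - u \in msupp g).
  rewrite (big_fsetD1 _ vu) /= eqxx big_seq_cond big1 ?addr0 // => x.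
  by rewrite andbT in_fsetD1 => /andP[/negbTE -> _].
rewrite mem_msupp negbK in vu; rewrite (eqP vu) mulr0 big_seq_cond big1 // => x.
by rewrite andbT => _; have [->|//] := eqVneq x (v - u); rewrite (eqP vu) mulr0 mul0rn //.
Qed.

Lemma gr_coef_expM u g v : gr_coef (gr_exp u * g) v = gr_coef g (v - u).
Proof. by rewrite gr_coef_monoM mul1r. Qed.

Lemma gr_coefM f g v :
  gr_coef (f * g) v = \sum_(u <- msupp f) gr_coef f u * gr_coef g (v - u).
Proof.
rewrite [f * g]gr_mulE1 gr_coef_sum; apply: eq_bigr => u _.
exact: gr_coef_monoM.
Qed.

End Coefficients.

(** * Euclidean geometry *)

Lemma coord_ext (R : fieldType) (V : vectType R) (u v : V) :
  (forall i, coord (vbasis fullv) i u = coord (vbasis fullv) i v) -> u = v.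
Proof.
move=> uv; rewrite (coord_vbasis (memvf u)) (coord_vbasis (memvf v)).
by apply: eq_bigr => i _; rewrite uv.
Qed.

(** Linear identities between vectors become field identities in each coordinate. *)
Ltac vec := apply: coord_ext => ?;
  rewrite ?(linearD, linearN, linearZ, linear0) /=; by field.

Section Euclid.
Variables (R : realType) (V : vectType R) (ip : {dot V for (@idfun R)}).
Implicit Types (u v w s t a b : V) (l : seq V).

Lemma ipC u v : ip u v = ip v u.
Proof. by rewrite (hermC ip) /= expr0 mul1r. Qed.

Lemma ipDr u v w : ip u (v + w) = ip u v + ip u w.
Proof. exact: raddfD. Qed.

Lemma ipNr u v : ip u (- v) = - ip u v.
Proof. exact: raddfN. Qed.

Lemma ipBr u v w : ip u (v - w) = ip u v - ip u w.
Proof. exact: raddfB. Qed.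

Lemma ip0r u : ip u 0 = 0.
Proof. exact: raddf0. Qed.

Lemma ipZr u (k : R) v : ip u (k *: v) = k * ip u v.
Proof. exact: linearZ. Qed.

Lemma ipDl u v w : ip (u + v) w = ip u w + ip v w.
Proof. by rewrite ipC ipDr !(ipC w). Qed.

Lemma ipNl u v : ip (- u) v = - ip u v.
Proof. by rewrite ipC ipNr ipC. Qed.

Lemma ipBl u v w : ip (u - v) w = ip u w - ip v w.
Proof. by rewrite ipDl ipNl. Qed.

Lemma ipZl (k : R) u v : ip (k *: u) v = k * ip u v.
Proof. by rewrite ipC ipZr ipC. Qed.

Lemma ip0l v : ip 0 v = 0.
Proof. by rewrite ipC ip0r. Qed.

Definition ipE :=
  (ipDl, ipDr, ipBl, ipBr, ipNl, ipNr, ipZl, ipZr, ip0l, ip0r).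

Lemma ip_gt0 v : v != 0 -> 0 < ip v v.
Proof. exact: neq0_dnorm_gt0. Qed.

Lemma ip_neq0 v : v != 0 -> ip v v != 0.
Proof. by move=> /ip_gt0; rewrite lt0r => /andP[]. Qed.

Lemma ip_ge0 v : 0 <= ip v v.
Proof. by have [->|/ip_gt0/ltW//] := eqVneq v 0; rewrite ip0l. Qed.

Lemma sqr_enorm v : enorm ip v ^+ 2 = ip v v.
Proof. exact/sqr_sqrtr/ip_ge0. Qed.

Definition coroot a v : R := 2 * ip a v / ip a a.

Lemma reflectionE a v : reflection ip a v = v - coroot a v *: a.
Proof. by rewrite /reflection sqr_enorm. Qed.

Lemma corootD a u v : coroot a (u + v) = coroot a u + coroot a v.
Proof. by rewrite /coroot ipDr mulrDr mulrDl. Qed.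

Lemma corootN a v : coroot a (- v) = - coroot a v.
Proof. by rewrite /coroot ipNr mulrN mulNr. Qed.

Lemma corootB a u v : coroot a (u - v) = coroot a u - coroot a v.
Proof. by rewrite corootD corootN. Qed.

Lemma corootZ a (k : R) v : coroot a (k *: v) = k * coroot a v.
Proof. by rewrite /coroot ipZr; ring. Qed.

Lemma corootNl a v : coroot (- a) v = - coroot a v.
Proof. by rewrite /coroot !ipE opprK mulrN mulNr. Qed.

Lemma coroot0 a : coroot a 0 = 0.
Proof. by rewrite /coroot ip0r mulr0 mul0r. Qed.

Lemma corootaa a : a != 0 -> coroot a a = 2.
Proof. by move=> a0; rewrite /coroot mulfK ?ip_neq0. Qed.

Lemma reflectionD a u v :
  reflection ip a (u + v) = reflection ip a u + reflection ip a v.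
Proof.
by rewrite !reflectionE corootD scalerDl opprD addrACA.
Qed.

Lemma reflectionZ a (k : R) v :
  reflection ip a (k *: v) = k *: reflection ip a v.
Proof. by rewrite !reflectionE corootZ scalerBr scalerA. Qed.

Lemma reflectionN a v : reflection ip a (- v) = - reflection ip a v.
Proof. by rewrite -scaleN1r reflectionZ scaleN1r. Qed.

Lemma reflectionB a u v :
  reflection ip a (u - v) = reflection ip a u - reflection ip a v.
Proof. by rewrite reflectionD reflectionN. Qed.

Lemma reflectionNl a v : reflection ip (- a) v = reflection ip a v.
Proof. by rewrite !reflectionE corootNl scalerN scaleNr opprK. Qed.

Lemma reflectionK a : involutive (reflection ip a).
Proof.
move=> v; have [->|a0] := eqVneq a 0; first by rewrite !reflectionE !scaler0 !subr0.
rewrite [LHS]reflectionE reflectionE corootB corootZ corootaa //.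
rewrite -addrA -opprD -scalerDl.
have -> : coroot a v + (coroot a v - coroot a v * 2) = 0 by ring.
by rewrite scale0r subr0.
Qed.

Lemma reflection_id a : a != 0 -> reflection ip a a = - a.
Proof.
move=> a0; rewrite reflectionE corootaa // scaler_nat mulr2n opprD addrA.
by rewrite subrr sub0r.
Qed.

Lemma ip_reflection a u v :
  ip (reflection ip a u) (reflection ip a v) = ip u v.
Proof.
have [->|a0] := eqVneq a 0; first by rewrite !reflectionE !scaler0 !subr0.
have := ip_neq0 a0 => aa; rewrite !reflectionE !ipE /coroot (ipC u a); field.
exact: aa.
Qed.

(** A form that kills the new vector [s] is perturbed along the component of [s] orthogonal to [t];
    only finitely many multiples spoil the earlier vectors. *)
Lemma generic_ip t l : (forall s, s \in l -> forall k : R, s <> k *: t) ->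
  exists u, ip u t = 0 /\ forall s, s \in l -> ip u s != 0.
Proof.
elim: l => [|s l IHl] lt; first by exists 0; rewrite ip0l.
have [|u [ut ul]] := IHl; first by move=> x xl; apply: lt; rewrite inE xl orbT.
have [us|us] := eqVneq (ip u s) 0; last first.
  by exists u; split=> // x; rewrite inE => /predU1P[->|/ul].
pose p := s - (ip s t / ip t t) *: t.
have pt : ip p t = 0.
  rewrite !ipE; have [->|t0] := eqVneq t 0; first by rewrite !ip0r mulr0 subrr.
  by rewrite divfK ?subrr // ip_neq0.
have p0 : p != 0 by rewrite subr_eq0; apply/eqP/lt; rewrite inE eqxx.
have ps : ip p s != 0.
  have := ipBr p s ((ip s t / ip t t) *: t); rewrite ipZr pt mulr0 subr0 => <-.
  exact: ip_neq0.
(* The multipliers to avoid: [0] because of [s], and for each [x] the one at which the perturbed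
   form kills [x]. *)
clearbody p; pose bad := 0 :: [seq - ip u x / ip p x | x <- l].
have [n nbad] : exists n : nat, n%:R \notin bad.
  apply: contrapT => /forallNP H.
  have /uniq_leq_size : uniq [seq n%:R : R | n <- iota 0 (size bad).+1].
    by rewrite map_inj_uniq ?iota_uniq // => i j /eqP; rewrite eqr_nat => /eqP.
  move=> /(_ bad); rewrite size_map size_iota ltnn => /(_ _)/notP[]//.
  by move=> _ /mapP[n _ ->]; apply/negPn/negP/H.
exists (u + n%:R *: p); split; first by rewrite !ipE ut pt mulr0 addr0.
move: nbad; rewrite inE negb_or => /andP[n0 /mapP nl] x.
rewrite inE !ipE => /predU1P[->|xl]; first by rewrite us add0r mulf_neq0.
apply/eqP => e; have [px|px] := eqVneq (ip p x) 0.
  by move: e (ul _ xl); rewrite px mulr0 addr0 => ->; rewrite eqxx.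
apply: nl; exists x => //; apply: (mulIf px); rewrite divfK //.
by apply/eqP; rewrite -addr_eq0 addrC e.
Qed.

End Euclid.

(** * Products of half differences *)

Section Denominator.
Variables (R : realType) (V : vectType R) (ip : {dot V for (@idfun R)}).
Implicit Types (u v w s t a b : V) (l : seq V) (f g : group_ring V).
Implicit Types phi psi : V -> R.

(** The linear extension of [phi] to the group ring; for the indicator of a coset it sums the
    coefficients there. *)
Definition gr_pair phi f : R := \sum_(v <- msupp f) (gr_coef f v)%:~R * phi v.

Lemma gr_pair_supp (X : seq V) phi f : uniq X ->
  (forall v, gr_coef f v != 0 -> phi v != 0 -> v \in X) ->
  gr_pair phi f = \sum_(v <- X) (gr_coef f v)%:~R * phi v.
Proof.
move=> uX fX; pose P v := (gr_coef f v)%:~R * phi v != 0 :> R.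
have split0 (Y : seq V) : \sum_(v <- Y) (gr_coef f v)%:~R * phi v =
    \sum_(v <- [seq v <- Y | P v]) (gr_coef f v)%:~R * phi v.
  rewrite big_filter [LHS](bigID P) /= [X in _ + X]big1 ?addr0 //.
  by move=> v /negPn/eqP.
rewrite /gr_pair (split0 (msupp f)) (split0 X); apply: perm_big; apply: uniq_perm.
- by rewrite seq.filter_uniq ?fset_uniq.
- by rewrite seq.filter_uniq.
move=> v; rewrite !mem_filter; case: (boolP (P v)) => //=.
by rewrite /P mulf_eq0 negb_or intr_eq0 mem_msupp => /andP[fv pv]; rewrite fv fX.
Qed.

Lemma gr_pairW (X : {fset V}) phi f : (msupp f `<=` X)%fset ->
  gr_pair phi f = \sum_(v <- X) (gr_coef f v)%:~R * phi v.
Proof.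
move=> /fsubsetP fX; apply: gr_pair_supp; first exact: fset_uniq.
by move=> v fv _; apply: fX; rewrite mem_msupp.
Qed.

Lemma gr_pairB phi f g : gr_pair phi (f - g) = gr_pair phi f - gr_pair phi g.
Proof.
rewrite (gr_pairW _ (msuppB_le f g)) (gr_pairW _ (fsubsetUl _ (msupp g))).
rewrite (gr_pairW _ (fsubsetUr (msupp f) _)) -sumrB; apply: eq_bigr => v _.
by rewrite gr_coefB rmorphB mulrBl.
Qed.

Lemma gr_pairN phi f : gr_pair phi (- f) = - gr_pair phi f.
Proof.
by rewrite -[- f]sub0r gr_pairB {1}/gr_pair msupp0 big_seq_fset0 sub0r.
Qed.

Lemma eq_gr_pair phi psi f : phi =1 psi -> gr_pair phi f = gr_pair psi f.
Proof. by move=> e; apply: eq_bigr => v _; rewrite e. Qed.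

Lemma gr_pair_funB phi psi f :
  gr_pair (fun v => phi v - psi v) f = gr_pair phi f - gr_pair psi f.
Proof. by rewrite -sumrB; apply: eq_bigr => v _; rewrite mulrBr. Qed.

Lemma gr_pair_funZ (k : R) phi f :
  gr_pair (fun v => k * phi v) f = k * gr_pair phi f.
Proof. by rewrite mulr_sumr; apply: eq_bigr => v _; rewrite mulrCA. Qed.

Lemma gr_pair_reindex (h k : V -> V) phi f g : cancel h k -> cancel k h ->
  (forall v, gr_coef f (h v) = gr_coef g v) ->
  gr_pair phi f = gr_pair (phi \o h) g.
Proof.
move=> hK kH fg; rewrite (@gr_pair_supp (map h (msupp g))).
- by rewrite big_map; apply: eq_bigr => v _; rewrite fg.
- by rewrite (map_inj_uniq (can_inj hK)) fset_uniq.
- move=> v fv _; apply/mapP; exists (k v); last by rewrite kH.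
  by rewrite mem_msupp -fg kH.
Qed.

Lemma gr_pair_expM u phi f :
  gr_pair phi (gr_exp u * f) = gr_pair (fun v => phi (v + u)) f.
Proof.
apply: (gr_pair_reindex _ (addrK u) (subrK u)) => v.
by rewrite gr_coef_expM addrK.
Qed.

(** * Indicator functions of the cosets of [Z a] *)

Definition coset_ind a y v : R := (`[< exists n : int, v = y + n%:~R *: a >])%:R.

Lemma coset_indP a y v : coset_ind a y v != 0 -> exists n : int, v = y + n%:~R *: a.
Proof. by rewrite /coset_ind; case: asboolP => //; rewrite eqxx. Qed.

Lemma coset_ind1 a y (n : int) : coset_ind a y (y + n%:~R *: a) = 1.
Proof. by rewrite /coset_ind; case: asboolP => // -[]; exists n. Qed.

Lemma coset_ind_id a y : coset_ind a y y = 1.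
Proof. by have := coset_ind1 a y 0; rewrite scale0r addr0. Qed.

Lemma coset_ind_shift a y v (n : int) :
  coset_ind a y (v + n%:~R *: a) = coset_ind a y v.
Proof.
congr (nat_of_bool _)%:R; apply: asbool_equiv_eq; split=> -[k e].
  by exists (k - n); rewrite rmorphB scalerBl addrA -e addrK.
by exists (k + n); rewrite e rmorphD scalerDl addrA.
Qed.

Lemma coset_ind_sub a y v x : coset_ind a y (v - x) = coset_ind a (y + x) v.
Proof.
congr (nat_of_bool _)%:R; apply: asbool_equiv_eq; split=> -[k e]; exists k.
  by rewrite addrAC -e subrK.
by rewrite e addrAC addrK.
Qed.

Lemma coset_ind_repr a y (n : int) v :
  coset_ind a (y + n%:~R *: a) v = coset_ind a y v.
Proof. by rewrite -coset_ind_sub -scaleNr -rmorphN coset_ind_shift. Qed.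

(** A unit multiple of [1 - gr_exp s], normalised to be odd in [s]. *)
Definition half_diff s : group_ring V :=
  gr_exp (- (2^-1 *: s)) - gr_exp (2^-1 *: s).

Lemma half_add s : 2^-1 *: s + 2^-1 *: s = s.
Proof. vec. Qed.

Lemma gr_coef_half_diffM s f v : gr_coef (half_diff s * f) v =
  gr_coef f (v + 2^-1 *: s) - gr_coef f (v - 2^-1 *: s).
Proof. by rewrite mulrBl gr_coefB !gr_coef_expM opprK. Qed.

Lemma gr_pair_half_diffM s phi f : gr_pair phi (half_diff s * f) =
  gr_pair (fun v => phi (v - 2^-1 *: s) - phi (v + 2^-1 *: s)) f.
Proof. by rewrite mulrBl gr_pairB !gr_pair_expM gr_pair_funB. Qed.

(** Multiplication by [half_diff s] is adjoint to a difference operator with step [s], which kills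
    [s]-periodic functions. *)
Lemma gr_pair_half_diffM0 s phi f : (forall v, phi (v + s) = phi v) ->
  gr_pair phi (half_diff s * f) = 0.
Proof.
move=> phis; rewrite gr_pair_half_diffM /gr_pair big1 // => v _.
have -> : v + 2^-1 *: s = v - 2^-1 *: s + s by vec.
by rewrite phis subrr mulr0.
Qed.

Lemma half_diffN s : half_diff (- s) = - half_diff s.
Proof. by rewrite /half_diff scalerN opprK opprB. Qed.

Lemma subr1_exp s : 1 - gr_exp s = gr_exp (2^-1 *: s) * half_diff s.
Proof. by rewrite mulrBr -!gr_expD subrr half_add. Qed.

(** For a system of positive roots this is, up to sign, the Weyl denominator. *)
Definition denom l : group_ring V := \prod_(s <- l) half_diff s.

Lemma denom_cons s l : denom (s :: l) = half_diff s * denom l.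
Proof. exact: big_cons. Qed.

Lemma denom_rem s l : s \in l -> denom l = half_diff s * denom (rem s l).
Proof. by move=> sl; rewrite /denom (perm_big _ (perm_to_rem sl)) big_cons. Qed.

Lemma prod_subr1_exp l :
  \prod_(s <- l) (1 - gr_exp s) = gr_exp (2^-1 *: \sum_(s <- l) s) * denom l.
Proof.
elim: l => [|s l IHl]; first by rewrite /denom !big_nil scaler0 mulr1.
by rewrite denom_cons !big_cons IHl subr1_exp scalerDr gr_expD; ring.
Qed.

(** * Vertices and edges of the Newton polytope *)

Definition is_top u f w : Prop := gr_coef f w != 0 /\
  forall v, gr_coef f v != 0 -> v != w -> ip u v < ip u w.

Lemma is_top0 u f w v : is_top u f w -> ip u w <= ip u v -> v != w ->
  gr_coef f v = 0.
Proof.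
by move=> [_ ftop] wv vw; apply/eqP; apply: contraTT wv => /ftop;
   rewrite -ltNge; apply.
Qed.

(** The top exponent of a product is the sum of the top exponents of the factors, here the half of
    [s] or [- s] on which [ip u] is positive. *)
Lemma denom_top u l : (forall s, s \in l -> ip u s != 0) ->
  is_top u (denom l) (\sum_(s <- l) (Num.sg (ip u s) / 2) *: s).
Proof.
elim: l => [_|s l IHl ul].
  rewrite /denom !big_nil; split; first by rewrite -gr_exp0 gr_coef_exp eqxx.
  by move=> v; rewrite -gr_exp0 gr_coef_exp (eq_sym 0); case: (v == 0).
have {}IHl : is_top u (denom l) (\sum_(s <- l) (Num.sg (ip u s) / 2) *: s).
  by apply: IHl => x xl; apply: ul; rewrite inE xl orbT.
have us : ip u s != 0 by apply: ul; rewrite inE eqxx.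
rewrite denom_cons big_cons; move: IHl; set w := \sum_(_ <- _) _ => topw.
wlog us0 : s us {ul} / 0 < ip u s.
  move=> H; have [/H|us0] := ltrP 0 (ip u s); first exact.
  have [||n1 n2] := H (- s).
  - by rewrite ipNr oppr_eq0.
  - by rewrite ipNr oppr_gt0 lt_neqAle us.
  move: n1 n2; rewrite half_diffN mulNr ipNr sgrN mulNr scalerN scaleNr opprK.
  rewrite gr_coefN oppr_eq0 => n1 n2; split=> // v; have := n2 v.
  by rewrite gr_coefN oppr_eq0.
rewrite gtr0_sg // mul1r; have [tw wtop] := topw; split.
  rewrite gr_coef_half_diffM.
  have -> : 2^-1 *: s + w + 2^-1 *: s = w + s by vec.
  have -> : 2^-1 *: s + w - 2^-1 *: s = w by vec.
  rewrite (is_top0 topw) ?sub0r ?oppr_eq0 //.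
    by rewrite ipDr lerDl ltW.
  by rewrite -subr_eq0 addrAC subrr add0r; apply: contraNneq us => ->; rewrite ip0r.
move=> v; rewrite gr_coef_half_diffM => cv vw; rewrite ipDr ipZr.
have [v0|v0] := eqVneq (gr_coef (denom l) (v + 2^-1 *: s)) 0.
  move: cv; rewrite v0 sub0r oppr_eq0 => /wtop; rewrite subr_eq addrC => /(_ vw).
  by rewrite ipBr ipZr; lra.
have : ip u (v + 2^-1 *: s) <= ip u w.
  by have [->|] := eqVneq (v + 2^-1 *: s) w => // /(wtop _ v0)/ltW.
by rewrite ipDr ipZr; lra.
Qed.

Lemma denom_neq0 l : (forall s, s \in l -> s != 0) -> denom l != 0.
Proof.
move=> l0; have [|u [_ ul]] := @generic_ip R V ip 0 l.
  by move=> s /l0 s0 k; rewrite scaler0; apply/eqP.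
have [+ _] := denom_top ul; apply: contraNneq => ->; exact/eqP/gr_coef0.
Qed.

(* If [ip u] vanishes on exactly one factor [a], the face of the Newton
   polytope where [ip u] is maximal is an edge in direction [a]. *)
Definition is_edge u a f w : Prop := [/\ gr_coef f (w - 2^-1 *: a) != 0,
  gr_coef f (w + 2^-1 *: a) = - gr_coef f (w - 2^-1 *: a) &
  forall v, gr_coef f v != 0 ->
    [\/ v = w - 2^-1 *: a, v = w + 2^-1 *: a | ip u v < ip u w]].

(** The vertex [w] of the product of the other factors is split by [half_diff a] into the two ends
    of the edge. *)
Lemma denom_edge u a l : a \in l -> a != 0 -> ip u a = 0 ->
  (forall s, s \in rem a l -> ip u s != 0) -> exists w, is_edge u a (denom l) w.
Proof.
move=> al a0 ua /denom_top; set w := \sum_(_ <- _) _ => topw; exists w.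
have [tw wtop] := topw; rewrite (denom_rem al).
(* [w - a] and [w + a] are as high as the unique maximum [w], so they do not occur and nothing
   cancels at the ends of the edge. *)
have cB : gr_coef (denom (rem a l)) (w - a) = 0.
  apply: (is_top0 topw); first by rewrite ipBr ua subr0.
  by rewrite -subr_eq0 addrAC subrr sub0r oppr_eq0.
have cD : gr_coef (denom (rem a l)) (w + a) = 0.
  apply: (is_top0 topw); first by rewrite ipDr ua addr0.
  by rewrite -subr_eq0 addrAC subrr add0r.
have wB : w - 2^-1 *: a - 2^-1 *: a = w - a by vec.
have wD : w + 2^-1 *: a + 2^-1 *: a = w + a by vec.
split; rewrite ?gr_coef_half_diffM ?subrK ?addrK ?wB ?wD ?cB ?cD ?subr0 ?sub0r //.
move=> v; rewrite gr_coef_half_diffM => cv.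
have [->|v1] := eqVneq v (w - 2^-1 *: a); first by constructor 1.
have [->|v2] := eqVneq v (w + 2^-1 *: a); first by constructor 2.
constructor 3; have [v0|v0] := eqVneq (gr_coef (denom (rem a l)) (v + 2^-1 *: a)) 0.
  move: cv; rewrite v0 sub0r oppr_eq0 => /wtop; rewrite subr_eq => /(_ v2).
  by rewrite ipBr ipZr ua mulr0 subr0.
rewrite -(inj_eq (addIr (2^-1 *: a))) subrK in v1; move/wtop: v0.
by rewrite ipDr ipZr ua mulr0 addr0; apply.
Qed.

End Denominator.

(** * From a sphere to a root system *)

Section SphereToRoots.
Variables (R : realType) (V : vectType R) (ip : {dot V for (@idfun R)}).
Variables (l : seq V) (c : V) (q : R).
Hypothesis l_neq0 : forall s, s \in l -> s != 0.
Hypothesis sphere_l : forall y, gr_coef (denom l) y != 0 ->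
  ip (y - c) (y - c) = q.

Let cf := gr_coef (denom l).

Definition affine_refl a v : V := c + reflection ip a (v - c).

Lemma affine_reflE a v : affine_refl a v = v - coroot ip a (v - c) *: a.
Proof. by rewrite /affine_refl reflectionE addrA [c + _]addrC subrK. Qed.

Lemma affine_reflK a : involutive (affine_refl a).
Proof.
by move=> v; rewrite /affine_refl [c + _ - c]addrC addKr reflectionK addrC subrK.
Qed.

Lemma affine_reflB a u v :
  affine_refl a u - affine_refl a v = reflection ip a (u - v).
Proof.
rewrite /affine_refl opprD addrACA subrr add0r -reflectionB.
by congr reflection; vec.
Qed.

(** On the line the equation of the sphere is quadratic in [k], with roots [0] and
    [- coroot ip a (y - c)]. *)
Lemma line_sphere a y (k : R) : a != 0 -> cf y != 0 -> cf (y + k *: a) != 0 ->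
  y + k *: a = y \/ y + k *: a = affine_refl a y.
Proof.
move=> /(ip_neq0 ip) aa /sphere_l ycq /sphere_l.
rewrite -ycq addrAC; move: (y - c) (affine_reflE a y) => z -> /eqP.
rewrite -subr_eq0 !ipE (ipC ip a z).
have -> : ip z z + k * ip z a + k * (ip z a + k * ip a a) - ip z z =
  k * (2 * ip z a + k * ip a a) by ring.
rewrite mulf_eq0 => /orP[/eqP->|]; first by rewrite scale0r addr0; left.
rewrite addr_eq0 => /eqP e; right; rewrite -scaleNr; congr (_ + _ *: _).
by apply: (mulIf aa); rewrite /coroot mulNr divfK // (ipC ip a z) e opprK.
Qed.

(** The coefficients on the coset of [y] modulo [Z a] sum to zero, and only [y] and [z] can
    contribute; so [z] differs from [y], lies in the coset and cancels [cf y]. *)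
Lemma partner a y : a \in l -> cf y != 0 ->
  [/\ affine_refl a y != y, coroot ip a (y - c) \is a Num.int &
      cf (affine_refl a y) = - cf y].
Proof.
move=> al cy; have a0 := l_neq0 al; set z := affine_refl a y.
pose phi := coset_ind a y; have phiy : phi y = 1 by exact: coset_ind_id.
have pair0 : gr_pair phi (denom l) = 0.
  rewrite (denom_rem al); apply: gr_pair_half_diffM0 => v.
  by rewrite -[in LHS](scale1r a); exact: (coset_ind_shift a y v 1).
have supp_phi v : cf v != 0 -> phi v != 0 -> v \in [:: y; z].
  move=> + /coset_indP[n e]; rewrite e.
  by move=> /(line_sphere a0 cy)[]->; rewrite !inE eqxx ?orbT.
have [zy|zy] := eqVneq z y.
  have := @gr_pair_supp _ _ [:: y] phi (denom l) isT.
  rewrite pair0 big_seq1 phiy mulr1 => H; case/eqP: cy; apply/eqP.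
  rewrite -(intr_eq0 R); apply/eqP/esym/H => v /supp_phi/[apply].
  by rewrite zy !inE orbb.
have /= := @gr_pair_supp _ _ [:: y; z] phi (denom l) _ supp_phi.
rewrite pair0 inE eq_sym zy big_cons big_seq1 phiy mulr1 => /(_ isT)/esym/eqP.
have [->|/coset_indP[n zn]] := eqVneq (phi z) 0.
  by rewrite mulr0 addr0 intr_eq0 (negPf cy).
rewrite zn /phi coset_ind1 -zn mulr1 -rmorphD intr_eq0 addrC addr_eq0 => /eqP czy.
split=> //; have : coroot ip a (y - c) *: a = (- n%:~R) *: a.
  by move: zn; rewrite /z affine_reflE => /addrI/eqP; rewrite eqr_oppLR scaleNr
    => /eqP.
move=> /eqP; rewrite -subr_eq0 -scalerBl scaler_eq0 (negPf a0) orbF subr_eq0.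
by move=> /eqP ->; rewrite -rmorphN intr_int.
Qed.

(** If [cf y = 0], apply [partner] to the image of [y], the affine reflection being an
    involution. *)
Lemma affine_refl_denom a y : a \in l -> cf (affine_refl a y) = - cf y.
Proof.
move=> al; have [cy|/(partner al)[]//] := eqVneq (cf y) 0.
rewrite cy oppr0; apply/eqP/negPn/negP => cz.
by have [_ _] := partner al cz; rewrite affine_reflK cy => /esym/eqP;
   rewrite oppr_eq0 (negPf cz).
Qed.

(* Two parallel factors would give a double zero along every line in their
   direction, impossible for a sum of two exponentials. *)
Lemma denom_not_parallel a b (k : R) : a \in l -> b \in rem a l -> b <> k *: a.
Proof.
move=> al bl eb; have a0 := l_neq0 al.
have /gr_neq0P[y cy] := denom_neq0 ip l_neq0.
have [zy _ cz] := partner al cy; set z := affine_refl a y in zy cz.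
pose one v : R := (`[< exists t : R, v = y + t *: a >])%:R.
have one_shift h v : one (v + h *: a) = one v.
  rewrite /one; congr (nat_of_bool _)%:R; apply: asbool_equiv_eq; split=> -[t e].
    by exists (t - h); rewrite scalerBl addrA -e addrK.
  by exists (t + h); rewrite e scalerDl addrA.
have oney : one y = 1.
  by rewrite /one; case: asboolP => // -[]; exists 0; rewrite scale0r addr0.
have onez : one z = 1.
  rewrite /one; case: asboolP => // -[]; exists (- coroot ip a (y - c)).
  by rewrite /z affine_reflE scaleNr.
(* A difference in direction [a] turns [phi] into a multiple of [one], which a difference in the
   parallel direction [b] kills. *)
pose phi v := one v * ip a v.
have pair0 : gr_pair phi (denom l) = 0.
  rewrite (denom_rem al) gr_pair_half_diffM.
  rewrite (eq_gr_pair (psi := fun v => - ip a a * one v)) => [|v]; last first.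
    by rewrite /phi -scaleNr !one_shift !ipE; field.
  rewrite gr_pair_funZ (denom_rem bl) gr_pair_half_diffM0 ?mulr0 // => v.
  by rewrite eb one_shift.
have /= := @gr_pair_supp _ _ [:: y; z] phi (denom l).
rewrite pair0 inE eq_sym zy big_cons big_seq1 -/cf cz /phi oney onez !mul1r.
rewrite rmorphN mulNr -mulrBr => /(_ isT).
move=> H; have {H}/esym/eqP : 0 = (cf y)%:~R * (ip a y - ip a z).
  apply: H => v cv; rewrite /one; case: asboolP => [[t e] _|]; last by rewrite mul0r eqxx.
  by move: cv; rewrite e => /(line_sphere a0 cy)[]->; rewrite !inE eqxx ?orbT.
rewrite mulf_eq0 intr_eq0 (negPf cy) /= -ipBr /z affine_reflE opprB addrC subrK.
rewrite ipZr mulf_eq0 (negPf (ip_neq0 ip a0)) orbF => /eqP e0.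
by move: zy; rewrite /z affine_reflE e0 scale0r subr0 eqxx.
Qed.

Lemma edge_of a : a \in l -> exists u w, is_edge ip u a (denom l) w.
Proof.
move=> al; have [x xl k|u [ua ul]] := @generic_ip _ _ ip a (rem a l).
  exact: denom_not_parallel.
by have [w ew] := denom_edge al (l_neq0 al) ua ul; exists u, w.
Qed.

(** [b] is the difference of the ends of an edge, and [partner] gives integrality at each end
    relative to [c]. *)
Lemma coroot_int a b : a \in l -> b \in l -> coroot ip a b \is a Num.int.
Proof.
move=> al bl; have [u [w [c1 c2 _]]] := edge_of bl.
have c2' : cf (w + 2^-1 *: b) != 0 by rewrite /cf c2 oppr_eq0.
have [_ i1 _] := partner al c1; have [_ i2 _] := partner al c2'.
have -> : b = (w + 2^-1 *: b - c) - (w - 2^-1 *: b - c) by vec.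
by rewrite corootB rpredB.
Qed.

(** Two descriptions of one face are compared: the reflected image of an edge of direction [s], and
    the face where a form vanishing on [t] is maximal. *)
Lemma refl_mem a s : a \in l -> s \in l ->
  (reflection ip a s \in l) || (- reflection ip a s \in l).
Proof.
move=> al sl; set t := reflection ip a s.
have t0 : t != 0.
  apply: contraNneq (l_neq0 sl) => e; rewrite -(reflectionK ip a s) -/t e.
  by rewrite reflectionE coroot0 scale0r subr0.
pose par x := `[< exists k : R, x = k *: t >].
(* [u] kills [t] but no factor off the line of [t]; its reflection kills [s] but no other factor,
   hence isolates an edge of direction [s]. *)
have [|u [ut ul]] := @generic_ip _ _ ip t
    ([seq x <- l | ~~ par x] ++ [seq reflection ip a x | x <- rem s l]).
  move=> x; rewrite mem_cat mem_filter => /orP[/andP[/asboolPn px _] k xk|].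
    by apply: px; exists k.
  case/mapP => y yl -> k /(congr1 (reflection ip a)).
  by rewrite reflectionZ !reflectionK; exact: denom_not_parallel.
have u'E v : ip (reflection ip a u) (affine_refl a v) =
    ip (reflection ip a u) c + ip u (v - c).
  by rewrite /affine_refl ipDr ip_reflection.
have [||x xl|w [c1 c2 ew]] := @denom_edge _ _ ip (reflection ip a u) s l sl.
- exact: l_neq0.
- by rewrite -(reflectionK ip a s) ip_reflection.
- rewrite -(reflectionK ip a x) ip_reflection ul // mem_cat orbC.
  by rewrite map_f.
have u's : ip (reflection ip a u) s = 0.
  by rewrite -(reflectionK ip a s) ip_reflection.
set P := affine_refl a (w - 2^-1 *: s); set Q := affine_refl a (w + 2^-1 *: s).
have cP : cf P != 0 by rewrite affine_refl_denom // oppr_eq0.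
have cQ : cf Q != 0 by rewrite affine_refl_denom // oppr_eq0 /cf c2 oppr_eq0.
have QP : Q - P = t.
  by rewrite affine_reflB; congr reflection; vec.
have uPQ : ip u Q = ip u P.
  by rewrite -[Q](subrK P) QP ipDr ut add0r.
have topP v : cf v != 0 -> ip u v <= ip u P.
  move=> cv; have cz : cf (affine_refl a v) != 0.
    by rewrite affine_refl_denom // oppr_eq0.
  have : ip (reflection ip a u) (affine_refl a v) <=
         ip (reflection ip a u) (affine_refl a P).
    rewrite /P affine_reflK ipBr ipZr u's mulr0 subr0.
    have [->|->|lt_w] := ew _ cz; last exact: ltW.
      by rewrite ipBr ipZr u's mulr0 subr0.
    by rewrite ipDr ipZr u's mulr0 addr0.
  by rewrite !u'E lerD2l !ipBr lerD2r.
(* If a factor [x] is parallel to [t], the top face for [u] is an edge of direction [x]. It has [P]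
   and [Q] as its ends, so [t] is [x] or [- x]. *)
have [/hasP[x xl /asboolP[k xk]]|/hasPn npar] := boolP (has par l).
  have ux : ip u x = 0 by rewrite xk ipZr ut mulr0.
  have [||w' [c1' c2' ew']] := @denom_edge _ _ ip u x l xl _ ux.
  - exact: l_neq0.
  - move=> y yl; apply: ul; rewrite mem_cat mem_filter (mem_rem yl) andbT.
    apply/orP; left; apply/asboolPn => -[k' yk'].
    have k0 : k != 0.
      by apply: contraNneq (l_neq0 xl) => k0; rewrite xk k0 scale0r.
    apply: (@denom_not_parallel x y (k' / k) xl yl).
    by rewrite xk scalerA divfK.
  have uw' : ip u w' <= ip u P.
    by have := topP _ c1'; rewrite ipBr ipZr ux mulr0 subr0.
  have [eP|eP|] := ew' _ cP; last by rewrite ltNge uw'.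
    have [eQ|eQ|] := ew' _ cQ; last by rewrite uPQ ltNge uw'.
      by move: t0; rewrite -QP eP eQ subrr eqxx.
    suff -> : t = x by rewrite xl.
    by rewrite -QP eP eQ; vec.
  have [eQ|eQ|] := ew' _ cQ; last by rewrite uPQ ltNge uw'.
    suff -> : t = - x by rewrite opprK xl orbT.
    by rewrite -QP eP eQ; vec.
  by move: t0; rewrite -QP eP eQ subrr eqxx.
(* Otherwise [ip u] has a unique maximum, although [P] and [Q] are distinct. *)
have [x xl|cw tw] := @denom_top _ _ ip u l.
  by apply: ul; rewrite mem_cat mem_filter xl npar.
have eP : P = \sum_(s <- l) (Num.sg (ip u s) / 2) *: s.
  by apply/eqP; apply/negPn/negP => /(tw _ cP); rewrite ltNge topP.
have eQ : Q = \sum_(s <- l) (Num.sg (ip u s) / 2) *: s.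
  by apply/eqP; apply/negPn/negP => /(tw _ cQ); rewrite uPQ ltNge topP.
by move: t0; rewrite -QP eP eQ subrr eqxx.
Qed.

End SphereToRoots.

(** * Divisibility by products of half differences *)

Section Division.
Variables (R : realType) (V : vectType R) (ip : {dot V for (@idfun R)}).
Implicit Types (u v w s t a b y : V) (l : seq V) (f g : group_ring V).

Lemma exists_max (F : V -> R) (s : seq V) : s != [::] ->
  exists2 x, x \in s & forall y, y \in s -> F y <= F x.
Proof.
elim: s => // x [|y s] IHs _.
  by exists x => [|z]; rewrite inE // => /eqP->.
have [//|z zs zmax] := IHs; have [le_xz|/ltW lt_zx] := leP (F x) (F z).
  by exists z => [|t]; rewrite inE ?zs ?orbT // => /predU1P[->|/zmax].
exists x => [|t]; first by rewrite inE eqxx.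
by rewrite inE => /predU1P[->|/zmax/le_trans]//; apply.
Qed.

Lemma gr_pair_neq0 (phi : V -> R) f : gr_pair phi f != 0 ->
  exists v, gr_coef f v != 0 /\ phi v != 0.
Proof.
move=> f0; apply: contrapT => /forallNP H; case/eqP: f0.
rewrite (@gr_pair_supp _ _ [::]) ?big_nil // => v fv pv.
by case: (H v).
Qed.

(** Telescoping: consecutive powers of [gr_exp a] differ by a multiple of [half_diff a]. *)
Lemma half_diff_dvd_exp a (n : int) :
  exists g, gr_exp (n%:~R *: a) - 1 = half_diff a * g.
Proof.
have step (k : int) : gr_exp ((k + 1)%:~R *: a) =
    gr_exp (k%:~R *: a) - gr_exp (k%:~R *: a) * gr_exp (2^-1 *: a) * half_diff a.
  rewrite -mulrA -subr1_exp mulrBr mulr1 subKr -gr_expD.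
  by rewrite rmorphD scalerDl scale1r.
elim: n => [|n [g e]|n [g e]].
- by exists 0; rewrite scale0r gr_exp0 subrr mulr0.
- exists (g - gr_exp (n%:~R *: a) * gr_exp (2^-1 *: a)).
  by rewrite -addn1 PoszD step addrAC e (mulrBr (half_diff a))
     [in RHS](mulrC (half_diff a) (_ * _)).
- exists (g + gr_exp ((- n.+1%:Z)%:~R *: a) * gr_exp (2^-1 *: a)).
  rewrite mulrDr -e (mulrC (half_diff a)).
  have -> : (- n%:Z) = - n.+1%:Z + 1 by rewrite -addn1 PoszD opprD addrNK.
  by rewrite step addrAC subrK.
Qed.

Lemma gr_monoE (k : int) u v : gr_mono k (u + v) = gr_mono k u * gr_exp v.
Proof. by rewrite [RHS]gr_mul_mono mulr1. Qed.

(* Every vector is congruent modulo [Z a] to exactly one [v] with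
   [0 <= ip a v / ip a a < 1]; replacing each exponent by it changes an element
   by a multiple of [half_diff a]. *)
Lemma half_diff_dvd a f : a != 0 ->
  (forall y, gr_pair (coset_ind a y) f = 0) -> exists g, f = half_diff a * g.
Proof.
move=> a0 f0; have aa := ip_neq0 ip a0.
pose rep v := v - (Num.floor (ip a v / ip a a))%:~R *: a.
have rep_shift v (n : int) : rep (v + n%:~R *: a) = rep v.
  rewrite /rep ipDr ipZr mulrDl mulfK // floorDrz ?intr_int // intrKfloor.
  by rewrite rmorphD scalerDl opprD addrACA subrr addr0.
have repK v : rep (rep v) = rep v.
  by rewrite {2}/rep -scaleNr -rmorphN rep_shift.
(* The coefficients of [h] at representatives are the coset sums of [f]; elsewhere they vanish. *)
pose h : group_ring V := \sum_(v <- msupp f) gr_mono (gr_coef f v) (rep v).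
have h0 : h = 0.
  apply: gr_ext => u; rewrite gr_coef0 gr_coef_sum; apply/eqP.
  rewrite -(intr_eq0 R) rmorph_sum /=.
  have [ru|ru] := eqVneq (rep u) u.
    rewrite -[X in _ == X](f0 u); apply/eqP; apply: eq_bigr => v _.
    rewrite gr_coef_mono -mulr_natr rmorphM /=; congr (_ * _).
    rewrite /coset_ind rmorph_nat; congr (nat_of_bool _)%:R.
    apply/eqP/asboolP => [<-|[n ->]]; last by rewrite rep_shift.
    by exists (Num.floor (ip a v / ip a a)); rewrite subrK.
  rewrite big1 // => v _; rewrite gr_coef_mono; case: eqP => // e.
  by case/eqP: ru; rewrite -e repK.
rewrite -[f]subr0 -h0 [f in f - _]monalgE -sumrB.
elim/big_ind: _ => [|f1 f2 [g1 ->] [g2 ->]|v _].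
- by exists 0; rewrite mulr0.
- by exists (g1 + g2); rewrite mulrDr.
have [g eg] := half_diff_dvd_exp a (Num.floor (ip a v / ip a a)).
exists (gr_mono (gr_coef f v) (rep v) * g).
rewrite mulrCA -eg mulrBr mulr1 -gr_monoE; congr (_ - _).
by rewrite subrK.
Qed.

(** By hypothesis the coset sums [h] of [f] are [b]-periodic; a nonzero one could be pushed along
    [b] beyond the finite support of [f]. *)
Lemma half_diff_cancel a b f : (forall k : R, b <> k *: a) ->
  (forall y, gr_pair (coset_ind a y) (half_diff b * f) = 0) ->
  forall y, gr_pair (coset_ind a y) f = 0.
Proof.
move=> ab bf0 y0; pose h y := gr_pair (coset_ind a y) f.
have hb y : h (y + b) = h y.
  have := bf0 (y + 2^-1 *: b); rewrite gr_pair_half_diffM gr_pair_funB.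
  rewrite (eq_gr_pair _ (coset_ind_sub _ _ ^~ _)) => /subr0_eq.
  rewrite -addrA half_add /h => ->; apply: eq_gr_pair => v.
  by rewrite -coset_ind_sub addrK.
have hP y : h y != 0 -> exists v (n : int),
    [/\ gr_coef f v != 0, v = y + n%:~R *: a & h v = h y].
  move=> /gr_pair_neq0[v [fv /coset_indP[n vn]]]; exists v, n; split=> //.
  by rewrite /h vn; apply: eq_gr_pair => x; rewrite coset_ind_repr.
have [u [ua ub]] : exists u, ip u a = 0 /\ 0 < ip u b.
  have [x /[!inE]/eqP -> //|u [ua ub]] := @generic_ip _ _ ip a [:: b].
  have /lt_total/orP[ub0|ub0] := ub b (mem_head _ _).
    by exists (- u); rewrite !ipNl ua oppr0 oppr_gt0.
  by exists u.
apply/eqP/negPn/negP => hy0; have [v0 [_ [fv0 _ hv0]]] := hP _ hy0.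
pose X := [seq v <- msupp f | h v != 0].
have XP v : (v \in X) = (h v != 0) && (gr_coef f v != 0).
  by rewrite mem_filter mem_msupp.
have [|v + vmax] := @exists_max (ip u) X.
  have : v0 \in X by rewrite XP hv0; apply/andP.
  by case: X {XP}.
(* The coset of [v + b] also has a nonzero sum, so it meets the support, at a point strictly higher
   than [v]. *)
rewrite XP -hb => /andP[hv _]; have [v' [n [fv' ev' hv']]] := hP _ hv.
have : v' \in X by rewrite XP fv' hv' hv.
by move=> /vmax; rewrite ev' !ipDr ipZr ua mulr0 addr0 gerDl leNgt ub.
Qed.

(** [rem] deletes a single occurrence, so a repeated vector counts as parallel to itself. *)
Definition pairwise_nonparallel l : Prop :=
  forall a b (k : R), a \in l -> b \in rem a l -> b <> k *: a.

Lemma pairwise_nonparallel_cons a l :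
  pairwise_nonparallel (a :: l) -> pairwise_nonparallel l.
Proof.
move=> npl x b k xl bl; apply: npl; first by rewrite inE xl orbT.
by rewrite /=; case: eqP => [_|_]; rewrite ?inE ?bl ?orbT ?(mem_rem bl).
Qed.

Lemma nonparallel_uniq l : pairwise_nonparallel l -> uniq l.
Proof.
elim: l => //= s k IHk npk; rewrite IHk ?andbT.
  by apply/negP => sk; apply: (npk s s 1); rewrite ?mem_head ?scale1r //= eqxx.
exact: pairwise_nonparallel_cons npk.
Qed.

(** The factors are divided out one by one; [half_diff_cancel] passes the conditions for the
    remaining factors on to the quotient. *)
Lemma denom_dvd l f : (forall s, s \in l -> s != 0) -> pairwise_nonparallel l ->
  (forall a y, a \in l -> gr_pair (coset_ind a y) f = 0) ->
  exists g, f = denom l * g.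
Proof.
elim: l f => [|a l IHl] f l0 npl fl.
  by exists f; rewrite /denom big_nil mul1r.
have al : a \in a :: l by exact: mem_head.
have sub b : b \in l -> b \in a :: l by rewrite inE orbC => ->.
have [g eg] := half_diff_dvd (l0 _ al) (fl a ^~ al).
have [|||h eh] := IHl g.
- by move=> s /sub/l0.
- exact: pairwise_nonparallel_cons npl.
- move=> b y bl; apply: (@half_diff_cancel b a g) => [k ab|z].
    apply: (npl a b k^-1 al _); first by rewrite /= eqxx.
    have k0 : k != 0 by apply: contraNneq (l0 _ al) => k0; rewrite ab k0 scale0r.
    by rewrite ab scalerA mulVf ?scale1r.
  by rewrite -eg; apply/fl/sub.
by exists h; rewrite denom_cons -mulrA -eh.
Qed.

(** Any other exponent [x] of [f] would need a partner [w + v - x] in [g] higher than [v]. The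
    maximum of [g] may be attained elsewhere too. *)
Lemma top_coefM u f g w v : is_top ip u f w ->
  (forall x, gr_coef g x != 0 -> ip u x <= ip u v) ->
  gr_coef (f * g) (w + v) = gr_coef f w * gr_coef g v.
Proof.
move=> [fw ftop] gmax; rewrite gr_coefM.
rewrite (bigD1_seq w) ?fset_uniq ?mem_msupp //= addrAC subrr add0r.
rewrite big_seq_cond big1 ?addr0 // => x /andP[+ xw]; rewrite mem_msupp => fx.
apply/eqP; rewrite mulf_eq0 orbC; apply/orP; left.
apply: contraTT (ftop _ fx xw) => /gmax; rewrite ipBr ipDr -leNgt; lra.
Qed.

End Division.

(** * From a root system to a sphere *)

Section RootsToSphere.
Variables (R : realType) (V : vectType R) (ip : {dot V for (@idfun R)}).
Variables (l : seq V).
Hypothesis l_neq0 : forall s, s \in l -> s != 0.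
Hypothesis l_nonparallel : pairwise_nonparallel l.
Hypothesis l_refl : forall a s, a \in l -> s \in l ->
  (reflection ip a s \in l) || (- reflection ip a s \in l).
Hypothesis l_int : forall a b, a \in l -> b \in l ->
  coroot ip a b \is a Num.int.

Let cf := gr_coef (denom l).

Lemma gr_coef_denom_refl a (k : seq V) v :
  gr_coef (denom (map (reflection ip a) k)) (reflection ip a v) =
  gr_coef (denom k) v.
Proof.
elim: k v => [|s k IHk] v.
  rewrite /denom !big_nil -gr_exp0 !gr_coef_exp.
  by rewrite -(inj_eq (inv_inj (reflectionK ip a))) reflectionK
     reflectionE coroot0 scale0r subr0.
rewrite map_cons !denom_cons !gr_coef_half_diffM -!reflectionZ.
by rewrite -reflectionD -reflectionB !IHk.
Qed.

Lemma denom_sign (nu : V -> V) (k : seq V) :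
  (forall s, s \in k -> nu s = s \/ nu s = - s) ->
  denom (map nu k) = denom k \/ denom (map nu k) = - denom k.
Proof.
elim: k => [|s k IHk] nuk; first by left.
rewrite map_cons !denom_cons.
have [|->|->] := IHk; first by move=> x xk; apply: nuk; rewrite inE xk orbT.
  have [->|->] := nuk s (mem_head _ _); first by left.
  by right; rewrite half_diffN mulNr.
have [->|->] := nuk s (mem_head _ _); first by right; rewrite mulrN.
by left; rewrite half_diffN mulrNN.
Qed.

Lemma opp_inj_nonparallel s t : s \in l -> t \in l -> s = t \/ s = - t -> s = t.
Proof.
move=> sl tl [//|e]; apply/eqP/negPn/negP => st.
apply: (l_nonparallel (k := -1) tl); last by rewrite scaleN1r; exact: e.
by rewrite mem_rem_uniq ?(nonparallel_uniq l_nonparallel) // inE st.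
Qed.

(** Reflecting [l] and then choosing by [nu] the representative in [l] up to sign permutes [l]; the
    choices only affect the sign of the product. *)
Lemma denom_refl a : a \in l ->
  denom (map (reflection ip a) l) = denom l \/
  denom (map (reflection ip a) l) = - denom l.
Proof.
move=> al; pose nu x := if x \in l then x else - x.
have nuE x : nu x = x \/ nu x = - x by rewrite /nu; case: ifP; [left|right].
set k := map (reflection ip a) l.
suff <- : denom (map nu k) = denom l.
  by have [->|->] := denom_sign (fun s (_ : s \in k) => nuE s);
    [left|right]; rewrite ?opprK.
rewrite /k -map_comp; apply: perm_big; rewrite perm_sym.
have uniq_nu : uniq (map (nu \o reflection ip a) l).
  rewrite map_inj_in_uniq ?(nonparallel_uniq l_nonparallel) // => s t sl tl /= e.
  apply: opp_inj_nonparallel => //.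
  have inj := inv_inj (reflectionK ip a).
  move: e; have [->|->] := nuE (reflection ip a s);
    have [->|->] := nuE (reflection ip a t).
  - by move/inj; left.
  - by rewrite -reflectionN => /inj; right.
  - by move/eqP; rewrite eqr_oppLR -reflectionN => /eqP/inj; right.
  - by move/oppr_inj/inj; left.
apply: uniq_perm => //; first exact: (nonparallel_uniq l_nonparallel).
have [||_ e] := @uniq_min_size _ _ l uniq_nu; last exact: fsym.
- move=> _ /mapP[s sl ->] /=; rewrite /nu.
  by case: ifP => // nsl; have := l_refl al sl; rewrite nsl.
- by rewrite size_map.
Qed.

(** [denom_refl] leaves a sign [eps] undetermined; an edge of direction [a], whose end coefficients
    are opposite, decides it. *)
Lemma denom_antisym a : a \in l ->
  (forall y, cf (reflection ip a y) = - cf y) /\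
  exists2 p, cf p != 0 & coroot ip a p \is a Num.int.
Proof.
move=> al; have a0 := l_neq0 al.
have [x xl k|u [ua ul]] := @generic_ip _ _ ip a (rem a l); first exact: l_nonparallel.
have [w [c1 c2 top]] := denom_edge al a0 ua ul.
set p := w - 2^-1 *: a in c1 c2 top; set p' := w + 2^-1 *: a in c2 top.
have pp' : p' = p + a by rewrite /p /p'; vec.
have up : ip u p = ip u w by rewrite ipBr ipZr ua mulr0 subr0.
have ur v : ip u (reflection ip a v) = ip u v.
  by rewrite reflectionE ipBr ipZr ua mulr0 subr0.
have edge v : cf v != 0 -> ip u v = ip u w -> v = p \/ v = p'.
  by move=> /top[]; [left|right|move=> + e; rewrite e ltxx].
have [eps epsE cfE] : exists2 eps : int, eps = 1 \/ eps = -1 &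
    forall y, cf (reflection ip a y) = eps * cf y.
  have [e|e] := denom_refl al.
    exists 1; [by left|move=> y].
    by rewrite mul1r -[RHS](gr_coef_denom_refl a) e.
  exists (-1); [by right|move=> y].
  by rewrite mulN1r /cf -[in RHS](gr_coef_denom_refl a l) e gr_coefN opprK.
have eps0 : eps != 0 by case: epsE => ->.
have cfr y : cf y != 0 -> cf (reflection ip a y) != 0.
  by move=> cy; rewrite cfE mulf_neq0.
(* The reflection preserves [ip u], hence the set of ends. If it fixed [p], it would send [p'] to
   [p - a], which is not an end; so it swaps them. *)
have [rp|rp] : reflection ip a p = p \/ reflection ip a p = p'.
- by apply: edge; [exact: cfr|rewrite ur].
- have cp0 : coroot ip a p = 0.
    apply/eqP; move/eqP: rp; rewrite reflectionE -subr_eq0 addrAC subrr sub0r.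
    by rewrite oppr_eq0 scaler_eq0 (negPf a0) orbF.
  have rp' : reflection ip a p' = p - a.
    by rewrite pp' reflectionD rp reflection_id.
  have [||e|e] := edge (reflection ip a p').
  - by apply: cfr; rewrite /cf c2 oppr_eq0.
  - by rewrite ur pp' ipDr ua addr0.
  - by move: a0; rewrite -oppr_eq0 -[- a](addKr p) -rp' e addNr eqxx.
  - have : a + a = p' - reflection ip a p' by rewrite rp' pp'; vec.
    by rewrite e subrr => /eqP; rewrite -mulr2n -scaler_nat
      scaler_eq0 pnatr_eq0 (negPf a0).
split=> [y|].
  move: (cfE p); rewrite rp /cf c2 -[LHS]mulN1r => /(mulIf c1) ep.
  by have := cfE y; rewrite -ep mulN1r.
exists p => //; have : coroot ip a p *: a = (- 1) *: a.
  by rewrite scaleN1r; apply/eqP; rewrite -eqr_oppLR -(inj_eq (addrI p))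
    -reflectionE rp pp'.
move=> /eqP; rewrite -subr_eq0 -scalerBl scaler_eq0 (negPf a0) orbF subr_eq0.
by move=> /eqP ->; rewrite rpredN rpred1.
Qed.

(** Exponents are signed half sums of [k], so they differ from the half sum by integral combinations
    of elements of [k]. *)
Lemma denom_supp_int a (k : seq V) y :
  (forall s, s \in k -> coroot ip a s \is a Num.int) ->
  gr_coef (denom k) y != 0 ->
  coroot ip a y - 2^-1 * coroot ip a (\sum_(s <- k) s) \is a Num.int.
Proof.
elim: k y => [|s k IHk] y kint.
  rewrite /denom !big_nil -gr_exp0 gr_coef_exp.
  have [<- _|_ /eqP//] := eqVneq 0 y; by rewrite coroot0 mulr0 subr0 rpred0.
have sint : coroot ip a s \is a Num.int by apply: kint; exact: mem_head.
have {}IHk z : gr_coef (denom k) z != 0 ->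
    coroot ip a z - 2^-1 * coroot ip a (\sum_(s <- k) s) \is a Num.int.
  by apply: IHk => x xk; apply: kint; rewrite inE xk orbT.
rewrite denom_cons gr_coef_half_diffM big_cons corootD => cy.
have [c0|/IHk] := eqVneq (gr_coef (denom k) (y + 2^-1 *: s)) 0.
  move: cy; rewrite c0 sub0r oppr_eq0 => /IHk; rewrite corootB corootZ.
  by congr (_ \is a _); ring.
rewrite corootD corootZ => H; rewrite -(rpredDr _ sint).
move: H; set b := coroot ip a (\sum_(_ <- _) _).
suff -> : coroot ip a y - 2^-1 * (coroot ip a s + b) + coroot ip a s =
  coroot ip a y + 2^-1 * coroot ip a s - 2^-1 * b by [].
by field.
Qed.

(** All exponents have the same coroot value modulo integers, and the edge end [p] has an integral
    one. *)
Lemma coroot_denom_int a y : a \in l -> cf y != 0 -> coroot ip a y \is a Num.int.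
Proof.
move=> al cy; have [_ [p cp pint]] := denom_antisym al.
have lint s : s \in l -> coroot ip a s \is a Num.int by exact: l_int.
rewrite -(rpredBr _ pint) -[_ - _](subrKA (2^-1 * coroot ip a (\sum_(s <- l) s))).
apply: rpredD; first exact: denom_supp_int lint cy.
by rewrite -opprB rpredN; exact: denom_supp_int lint cp.
Qed.

Lemma denom_part_eq0 (r : R) u : (forall s, s \in l -> ip u s != 0) ->
  let w := \sum_(s <- l) (Num.sg (ip u s) / 2) *: s in
  r != ip w w -> forall y, ip y y = r -> cf y = 0.
Proof.
move=> ul w rw y yr; apply/eqP/negPn/negP => cy.
pose f : group_ring V :=
  [malg v in msupp (denom l) => if ip v v == r then cf v else 0]%M.
have fE v : gr_coef f v = if ip v v == r then cf v else 0.
  rewrite /gr_coef /f mcoeffE; case: ifPn => //; rewrite mem_msupp negbK.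
  by rewrite /cf => /eqP ->; rewrite if_same.
have f_antisym a v : a \in l -> gr_coef f (reflection ip a v) = gr_coef (- f) v.
  move=> al; rewrite gr_coefN !fE ip_reflection; case: eqP; rewrite ?oppr0 // => _.
  by have [-> _] := denom_antisym al.
have f_supp v : gr_coef f v != 0 -> cf v != 0.
  by rewrite fE; case: ifP; rewrite ?eqxx.
have f_coset a z : a \in l -> gr_pair (coset_ind a z) f = 0.
  move=> al; have rK := reflectionK ip a.
  have := gr_pair_reindex (coset_ind a z) rK rK (f_antisym a ^~ al).
  rewrite gr_pairN.
  (* By integrality the reflection moves exponents within their coset modulo [Z a], so by
     antisymmetry the pairing equals its own negative. *)
  have -> : gr_pair (coset_ind a z \o reflection ip a) f = gr_pair (coset_ind a z) f.
    apply: eq_big_seq => v; rewrite mem_msupp => /f_supp /(coroot_denom_int al).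
    move=> /intrP[n en] /=; congr (_ * _).
    by rewrite reflectionE en -scaleNr -rmorphN coset_ind_shift.
  by move/eqP; rewrite -addr_eq0 -mulr2n mulrn_eq0 => /eqP.
have [g fg] := denom_dvd ip l_neq0 l_nonparallel f_coset.
have g0 : msupp g != [::] :> seq V.
  apply: contraNneq cy => g0; have : gr_coef f y = 0.
    rewrite fg mulrC gr_coefM g0 big_nil //.
  by rewrite fE yr eqxx => ->.
(* The top term at [w' + v] survives in [f], so it is an exponent of [denom l]. It is not [w'],
   which is off the sphere of [f], hence it lies strictly below. *)
have top_lt0 x w' : is_top ip x (denom l) w' -> ip w' w' = ip w w ->
    exists v, [/\ gr_coef g v != 0, ip x v < 0 &
      forall z, gr_coef g z != 0 -> ip x z <= ip x v].
  move=> topw ww'; have [v vg vmax] := exists_max (ip x) g0.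
  rewrite mem_msupp in vg.
  have {}vmax z : gr_coef g z != 0 -> ip x z <= ip x v.
    by rewrite -mem_msupp => /vmax.
  exists v; split=> //.
  have fwv : gr_coef f (w' + v) != 0.
    by rewrite fg (top_coefM topw) // mulf_neq0 //; case: topw.
  have wv : w' + v != w'.
    by apply: contraNneq fwv => ->; rewrite fE ww' (eq_sym _ r) (negPf rw).
  by have := topw.2 _ (f_supp _ fwv) wv; rewrite ipDr gtrDl.
have topu := denom_top ul.
have topNu : is_top ip (- u) (denom l) (- w).
  have -> : - w = \sum_(s <- l) (Num.sg (ip (- u) s) / 2) *: s.
    by rewrite -sumrN; apply: eq_bigr => s _; rewrite ipNl sgrN mulNr scaleNr.
  by apply: denom_top => s sl; rewrite ipNl oppr_eq0 ul.
have [v1 [gv1 uv1 max1]] := top_lt0 _ _ topu erefl.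
have [|v2 [gv2 uv2 _]] := top_lt0 _ _ topNu; first by rewrite ipNl ipNr opprK.
by have := max1 _ gv2; rewrite ipNl in uv2; lra.
Qed.

Lemma denom_sphere : l != [::] -> exists2 q, 0 < q &
  forall y, cf y != 0 -> ip y y = q.
Proof.
move=> lN0; have [x xl k|u [_ ul]] := @generic_ip _ _ ip 0 l.
  by rewrite scaler0; apply/eqP/l_neq0.
have [cw _] := denom_top ul; set w := \sum_(_ <- _) _ in cw.
exists (ip w w) => [|y cy]; last first.
  apply/eqP/negPn/negP => yw; case/eqP: cy.
  exact: (denom_part_eq0 ul yw).
(* The origin is fixed by every reflection, so antisymmetry forces its coefficient to vanish. *)
apply: ip_gt0; apply: contraNneq cw => w0.
have [a al] : exists a, a \in l by case: l lN0 => // a k _; exists a; exact: mem_head.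
have [/(_ 0) + _] := denom_antisym al; rewrite w0 reflectionE coroot0 scale0r subr0.
by move=> /eqP; rewrite -addr_eq0 -mulr2n mulrn_eq0.
Qed.

End RootsToSphere.

Local Open Scope classical_set_scope.

(** * The two conditions *)

Section Main.
Variables (R : realType) (V : vectType R) (ip : {dot V for (@idfun R)}).
Variable m : V -> nat.
Hypothesis m0 : m 0 = 0%N.
Hypothesis Sfin : finite_set (mult_supp m).

Let S := mult_supp m.

Lemma mem_fset_supp s : (s \in fset_set S) = (m s != 0%N).
Proof. by rewrite in_fset_set //; apply/idP/idP; rewrite inE. Qed.

Lemma LambdaE l v : gr_F m = \prod_(s <- l) (1 - gr_exp s) ->
  Lambda m v <-> gr_coef (denom l) (v - 2^-1 *: \sum_(s <- l) s) != 0.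
Proof. by rewrite prod_subr1_exp /Lambda /= => ->; rewrite gr_coef_expM. Qed.

(** Multiplicities become repetitions, so that [gr_F m] is a product of first powers. *)
Definition supp_seq : seq V := flatten [seq nseq (m s) s | s <- fset_set S].

Lemma mem_supp_seq s : (s \in supp_seq) = (m s != 0%N).
Proof.
apply/flattenP/idP => [[_ /mapP[t _ ->]]|ms].
  by rewrite mem_nseq lt0n => /andP[mt /eqP ->].
exists (nseq (m s) s); last by rewrite mem_nseq lt0n ms eqxx.
by apply: map_f; rewrite mem_fset_supp.
Qed.

Lemma gr_F_supp_seq : gr_F m = \prod_(s <- supp_seq) (1 - gr_exp s).
Proof.
rewrite big_flatten big_map; apply: eq_bigr => s _.
by rewrite big_nseq iter_mulr_1.
Qed.

Lemma uniq_supp_seq s : uniq supp_seq -> m s != 0%N -> m s = 1%N.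
Proof.
move=> + ms; have : s \in fset_set S by rewrite mem_fset_supp.
rewrite /supp_seq; case/splitPr => p1 p2.
rewrite map_cat flatten_cat /= !cat_uniq => /and3P[_ _ /andP[+ _]].
by case: (m s) ms => [|[|n]] //= _; rewrite inE eqxx.
Qed.

Lemma mem_signP (A : set V) a : (A `|` opp_set A) a <->
  exists2 b, A b & a = b \/ a = - b.
Proof.
split=> [[Aa|[b Ab <-]]|[b Ab [->|->]]].
- by exists a; [|left].
- by exists b; [|right].
- by left.
- by right; exists b.
Qed.

Lemma F1_F2 (N : nat) : \dim {:V} = N -> spans S -> condF1 ip m -> condF2 ip N m.
Proof.
move=> dimV Sspan [c [r [_ Lsph]]].
pose l := supp_seq; pose c0 := 2^-1 *: \sum_(s <- l) s.
have lE s : (s \in l) = (m s != 0%N) := mem_supp_seq s.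
have lS s : S s -> s \in l by rewrite lE.
have l0 s : s \in l -> s != 0.
  by rewrite lE; apply: contraNneq => ->; rewrite m0.
(* Passing from [gr_F m] to [denom l] translates exponents by [- c0], and the centre with them. *)
have sph y : gr_coef (denom l) y != 0 ->
    ip (y - (c - c0)) (y - (c - c0)) = r ^+ 2.
  move=> cy; rewrite opprB addrA -(Lsph (y + c0)) ?sqr_enorm //.
  by apply/(LambdaE _ gr_F_supp_seq); rewrite addrK.
have npl : pairwise_nonparallel l by move=> a b k; exact: denom_not_parallel sph _ _ _.
have npl' a b (k : R) : a \in l -> b \in l -> b = k *: a -> b = a.
  move=> al bl e; apply/eqP/negPn/negP => ba; apply: (npl a b k al _ e).
  by rewrite mem_rem_uniq ?(nonparallel_uniq npl) // inE ba.
have refl_mem a b : (S `|` opp_set S) a -> (S `|` opp_set S) b ->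
    (S `|` opp_set S) (reflection ip a b).
  move=> /mem_signP[a' a'S ea] /mem_signP[b' b'S eb].
  have -> : reflection ip a b = reflection ip a' b.
    by case: ea => ->; rewrite ?reflectionNl.
  have : (S `|` opp_set S) (reflection ip a' b').
    move/lS: a'S => a'S; move/lS: b'S => b'S.
    have /orP[] := refl_mem l0 sph a'S b'S; rewrite lE; first by left.
    by right; exists (- reflection ip a' b'); rewrite ?opprK.
  move=> /mem_signP[x Sx ex]; apply/mem_signP; exists x => //.
  case: eb ex => ->; rewrite ?reflectionN // => -[->|->]; rewrite ?opprK; by [left|right].
split.
- rewrite -subset0 => a [Sa [b Sb ba]].
  move/lS: Sa => Sa; move/lS: Sb => Sb.
  (* Parallel members of [l] coincide, so [a = - a], which is impossible for a nonzero vector. *)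
  have e : b = a by apply: (npl' a b (-1)) => //; rewrite scaleN1r -ba opprK.
  have := l0 _ Sa; rewrite -ba e => /eqP[]; apply/eqP.
  have : a + a = 0 by rewrite -{2}ba e subrr.
  by move/eqP; rewrite -mulr2n -scaler_nat scaler_eq0 pnatr_eq0 oppr_eq0.
- split=> //.
  + move=> a /mem_signP[b /lS/l0 b0 [->|->]] //=.
    by rewrite oppr_eq0.
  + move=> v; have [X XS vX] := Sspan v; exists X => // x /XS; by left.
  + move=> a Ra; apply/seteqP; split=> [_ [b Rb <-]|b Rb]; first exact: refl_mem.
    by exists (reflection ip a b); [exact: refl_mem|rewrite reflectionK].
  move=> a b /mem_signP[a' Sa ea] /mem_signP[b' Sb eb].
  move/lS: Sa => Sa; move/lS: Sb => Sb.
  rewrite sqr_enorm -/(coroot ip a b).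
  have := coroot_int l0 sph Sa Sb.
  by case: ea => ->; case: eb => ->; rewrite ?corootNl ?corootN ?opprK // rpredN.
- move=> a /mem_signP[a' Sa ea]; apply/seteqP; split=> x /=.
    move=> [[k _ kax] /mem_signP[x' Sx ex]]; move/lS: Sa => Sa; move/lS: Sx => Sx.
    have [h eh] : exists h : R, x' = h *: a'.
      case: ea kax => ->; case: ex => -> e.
      - by exists k.
      - by exists (- k); rewrite scaleNr e opprK.
      - by exists (- k); rewrite -e scalerN scaleNr.
      - by exists k; apply: oppr_inj; rewrite -e scalerN.
    have xa := npl' _ _ _ Sa Sx eh.
    by case: ea ex => -> [->|->]; rewrite xa ?opprK; [left|right|right|left].
  have Ra : (S `|` opp_set S) a by apply/mem_signP; exists a'.
  have RNa : (S `|` opp_set S) (- a).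
    by apply/mem_signP; exists a' => //; case: ea => ->; rewrite ?opprK; [right|left].
  move=> [->|->]; split=> //; [exists 1|exists (-1)] => //.
    by rewrite scale1r.
  by rewrite scaleN1r.
(* A multiplicity above one would repeat [s] in [supp_seq], giving parallel factors. *)
- by move=> s; apply: uniq_supp_seq; exact: nonparallel_uniq.
Qed.

Lemma F2_F1 (N : nat) : S !=set0 -> condF2 ip N m -> condF1 ip m.
Proof.
move=> [s0 Ss0] [Sdisj [_ R0 _ Rrefl Rint] Rred m1].
pose l : seq V := fset_set S.
have lE s : (s \in l) = (m s != 0%N) := mem_fset_supp s.
have Sl s : s \in l -> S s by rewrite lE.
have FE : gr_F m = \prod_(s <- l) (1 - gr_exp s).
  by apply: eq_big_seq => s; rewrite lE => /m1 ->; rewrite expr1.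
have lR s : s \in l -> (S `|` opp_set S) s by move=> /Sl; left.
have npl : pairwise_nonparallel l.
  move=> a b k al; rewrite mem_rem_uniq ?fset_uniq // inE => /andP[ba bl] e.
  (* Reducedness leaves only [b = - a], which disjointness of the support and its opposite
     excludes. *)
  have : ([set k *: a | k in [set: R]] `&` (S `|` opp_set S)) b.
    by split; [exists k|exact: lR].
  rewrite (Rred _ (lR _ al)) => -[/eqP|eb]; first by rewrite (negPf ba).
  suff : (S `&` opp_set S) a by rewrite Sdisj.
  split; first exact: Sl; exists b; first exact: Sl.
  by rewrite eb opprK.
have [|a s al sl|a b al bl||q q0 sph] := @denom_sphere _ _ ip l _ npl.
- by move=> s /lR/R0.
- have : (S `|` opp_set S) (reflection ip a s).
    by rewrite -(Rrefl a (lR _ al)); exists s => //; exact: lR.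
  move=> [|[b Sb <-]]; rewrite lE ?opprK; first by move=> ->.
  by rewrite [b \in l]lE orbC (Sb : m b != 0%N).
- by have := Rint _ _ (lR _ al) (lR _ bl); rewrite sqr_enorm.
- by apply: contraTneq (Ss0 : m s0 != 0%N) => l_nil; rewrite -lE l_nil.
exists (2^-1 *: \sum_(s <- l) s), (Num.sqrt q); split; first by rewrite sqrtr_gt0.
by move=> v /(LambdaE _ FE) /sph e; rewrite /enorm e.
Qed.

End Main.

Theorem theorem2p5 (R : realType) (N : nat) (hN : (1 <= N)%N)
    (V : vectType R) (hV : \dim {:V} = N) (ip : {dot V for (@idfun R)})
    (m : V -> nat) (m0 : m 0 = 0%N)
    (Sfin : finite_set (mult_supp m)) (Sne : mult_supp m !=set0)
    (Sspan : spans (mult_supp m)) :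
  condF1 ip m <-> condF2 ip N m.
Proof. by split; [exact: F1_F2|exact: F2_F1]. Qed.
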